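(* Let $\bar\xi\ge\xi_1,\xi_2\ge\underline\xi>0$. Let $\nu_{t,1}^s$ and $\nu_{t,2}^s$ be uniform $\mathcal{U}_{[0,1]}$ draws and $$e_{t,1}^s=-\left(\frac1{\nu_{t,1}^s}-1\right)^{\frac1{2+\xi_1}},\qquad e_{t,2}^s=\left(\frac1{1-\nu_{t,2}^s}-1\right)^{\frac1{2+\xi_2}}.$$ The densities of $e_{t,1}^s,e_{t,2}^s$ satisfy $f_{e_{t,1}^s}(e)\sim|e|^{-3-\xi_1}$ as $e\to-\infty$ and $f_{e_{t,2}^s}(e)\sim e^{-3-\xi_2}$ as $e\to+\infty$, where $\sim$ means that the ratio converges to a finite positive constant. There exists a finite $C$ bounding the second moments: $\mathbb{E}(|e_{t,1}^s|^2)\le C<\infty$ and $\mathbb{E}(|e_{t,2}^s|^2)\le C<\infty$. Furthermore, the draws $e_{t,1}^s$ and $e_{t,2}^s$ are $L^2$-smooth in $\xi_1$ and $\xi_2$ respectively: $$\left[\mathbb{E}\left(\sup_{|\xi_1-\tilde\xi_1|\le\delta}|e_{t,1}^s(\xi_1)-e_{t,1}^s(\tilde\xi_1)|^2\right)\right]^{1/2}\le C\delta,\qquad\left[\mathbb{E}\left(\sup_{|\xi_2-\tilde\xi_2|\le\delta}|e_{t,2}^s(\xi_2)-e_{t,2}^s(\tilde\xi_2)|^2\right)\right]^{1/2}\le C\delta,$$ where the constant $C$ only depends on $\underline\xi$ and $\bar\xi$.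
   Context: $e_{t,a}^s(\xi)$ denotes the draw computed with tail parameter $\xi$ from the same uniform $\nu_{t,a}^s$; all tail parameters, including those in the suprema, range over $[\underline\xi,\bar\xi]$. *)

(* Defs.v *)
From HB Require Import structures.
From mathcomp Require Import all_boot all_order all_algebra.
From mathcomp Require Import all_classical all_reals all_analysis.

Set Implicit Arguments.
Unset Strict Implicit.
Unset Printing Implicit Defensive.

Import Order.TTheory GRing.Theory Num.Theory.
Import numFieldNormedType.Exports.

Local Open Scope classical_set_scope.
Local Open Scope ring_scope.

(* The boundary values u = 0 and u = 1, where the totalized inverse [0^-1 = 0]
   makes these formulas meaningless, form a null set for the uniform law. *)
Definition left_draw (R : realType) (xi u : R) : R :=
  - ((u^-1 - 1) `^ (2 + xi)^-1).

Definition right_draw (R : realType) (xi u : R) : R :=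
  ((1 - u)^-1 - 1) `^ (2 + xi)^-1.

(* Equality of laws is only required on measurable sets: the values of the two
   set functions elsewhere carry no information. *)
Definition uniform01 d (T : measurableType d) (R : realType)
    (P : probability T R) (nu : {RV P >-> R}) : Prop :=
  forall A : set R, measurable A ->
    distribution P nu A = uniform_prob (@ltr01 R) A.

Definition has_density d (T : measurableType d) (R : realType)
    (P : probability T R) (X : T -> R) (f : R -> R) : Prop :=
  [/\ measurable_fun [set: T] X,
      measurable_fun [set: R] f,
      (forall x, 0 <= f x) &
      forall A : set R, measurable A ->
        (P (X @^-1` A) = \int[lebesgue_measure]_(x in A) (f x)%:E)%E].

(* Weaker than the library's [f ~_F g], which forces the limit to be 1. *)
Definition same_tail (R : realType) (F : set_system R) (f g : R -> R) : Prop :=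
  exists2 c : R, 0 < c & f x / g x @[x --> F] --> c.

(* The supremum runs over both parameters, at each sample point [w]. *)
Definition L2_smooth d (T : measurableType d) (R : realType)
    (P : probability T R) (lo hi C : R) (e : R -> T -> R) : Prop :=
  forall delta : R, 0 <= delta ->
    (sqrte (\int[P]_w ereal_sup
       [set z | exists x y : R,
          [/\ (lo <= x <= hi)%R, (lo <= y <= hi)%R, (`|x - y| <= delta)%R &
              z = (`|e x w - e y w| ^+ 2)%:E]])
     <= (C * delta)%:E)%E.

(* Main.v *)
(* Both draws are, up to sign, Y = (1/V - 1)^(1/b) with b = 2 + xi, where V is
   nu_1 for the left draw and 1 - nu_2 for the right one; in both cases
   P(V <= t) = t.  Hence P(Y >= a) = P(V <= 1/(1 + a^b)) = 1/(1 + a^b) for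
   a >= 0, and the law of Y has density b x^(b-1)/(1 + x^b)^2 on x >= 0, which
   is equivalent to b x^(-b-1).

   With y = 1/V - 1, the mean value inequality in the exponent gives
   |y^p - y^p'| <= |p - p'| |ln y| max(y^p, y^p').  For exponents p in
   [1/(2+hi), 1/(2+lo)] and 1/(2+lo) < s < 1/2, the factor |ln y| y^p is at most
   K (1 + y^s), so the moments and the supremum are all dominated by a multiple
   of 1 + y^(2s).  Since 2s < 1, E y^(2s) is bounded by a geometric series,
   splitting according to the dyadic size of V. *)
Require Import Defs.
From HB Require Import structures.
From mathcomp Require Import all_boot all_order all_algebra.
From mathcomp Require Import all_classical all_reals all_analysis.
From mathcomp Require Import measurable_realfun ring lra.

Set Implicit Arguments.
Unset Strict Implicit.
Unset Printing Implicit Defensive.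

Import Order.TTheory GRing.Theory Num.Theory.
Import numFieldNormedType.Exports.

Local Open Scope classical_set_scope.
Local Open Scope ring_scope.

(** * Powers as functions of their exponent *)

Lemma expR_dist_le (R : realType) (p q : R) :
  p <= q -> `|expR p - expR q| <= (q - p) * expR q.
Proof.
move=> pq; rewrite distrC ger0_norm ?subr_ge0 ?ler_expR//.
have -> : expR q - expR p = (1 - expR (p - q)) * expR q.
  by rewrite mulrBl mul1r -expRD subrK.
by rewrite ler_pM2r ?expR_gt0// lerBlDr; have := expR_ge1Dx (p - q); lra.
Qed.

Lemma powR_dist_le (R : realType) (y a b m : R) : 0 < y ->
  `|ln y| * y `^ a <= m -> `|ln y| * y `^ b <= m ->
  `|y `^ a - y `^ b| <= `|a - b| * m.
Proof.
(* Ordering [a * ln y] and [b * ln y] instead of [a] and [b] treats y < 1 and y > 1 at once. The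
   maximum of the two powers may sit at either exponent, hence the two hypotheses on [m]. *)
move=> y0; wlog ab : a b / a * ln y <= b * ln y => [hw ha hb|ha hb].
  by case/orP: (le_total (a * ln y) (b * ln y)) => h;
    [exact: hw|rewrite distrC (distrC a); exact: hw].
apply: le_trans (ler_wpM2l (normr_ge0 (a - b)) hb).
rewrite mulrA -normrM /powR gt_eqF//.
apply: (le_trans (expR_dist_le ab)); rewrite ler_wpM2r ?expR_ge0//.
by rewrite -mulrBl -normrN -mulNr opprB ler_norm.
Qed.

(** Everything follows from t <= e^(kt) / k. For y >= 1, take t = ln y and k = s - aM: the gap
    between aM and s pays for the logarithm. For y < 1, take t = - ln y and k = am: the factor
    y^(-am) is cancelled by y^c <= y^am, which leaves a constant. *)
Lemma ln_powR_le (R : realType) (y am aM s c : R) : 0 < y -> 0 < am -> aM < s ->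
  am <= c <= aM -> `|ln y| * y `^ c <= ((s - aM)^-1 + am^-1) * (1 + y `^ s).
Proof.
move=> y0 am0 aMs /andP[ac cM].
have ys := powR_ge0 y s.
have e0 : 0 < s - aM by rewrite subr_gt0.
have ei : 0 < (s - aM)^-1 by rewrite invr_gt0.
have ai : 0 < am^-1 by rewrite invr_gt0.
have lin (t k : R) : 0 < k -> t <= k^-1 * expR (k * t).
  move=> k0; rewrite ler_pdivlMl//.
  by have := expR_ge1Dx (k * t); lra.
have yE u : y `^ u = expR (u * ln y) by rewrite /powR gt_eqF.
have [y1|y1] := leP 1 y.
  have l0 : 0 <= ln y by rewrite ln_ge0.
  have h1 : ln y * y `^ c <= (s - aM)^-1 * y `^ s.
    have -> : s = (s - aM) + aM by rewrite subrK.
    rewrite yE [y `^ _]yE mulrDl expRD subrK mulrA.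
    apply: ler_pM; rewrite ?expR_ge0//; first exact: lin.
    by rewrite ler_expR ler_wpM2r.
  rewrite ger0_norm//; apply: (le_trans h1).
  nra.
have l0 : ln y <= 0 by rewrite ln_le0// ltW.
rewrite ler0_norm//.
have h1 : - ln y * y `^ c <= am^-1.
  have : - ln y * y `^ c <= (am^-1 * expR (am * - ln y)) * expR (am * ln y).
    rewrite yE; apply: ler_pM; rewrite ?expR_ge0 ?oppr_ge0//; first exact: lin.
    by rewrite ler_expR; nra.
  by rewrite -mulrA -expRD mulrN addNr expR0 mulr1.
by apply: (le_trans h1); nra.
Qed.

Lemma powR_exponent_lipschitz (R : realType) (y am aM s a b : R) :
  0 < am -> aM < s -> am <= a <= aM -> am <= b <= aM ->
  `|y `^ a - y `^ b| <= `|a - b| * (((s - aM)^-1 + am^-1) * (1 + y `^ s)).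
Proof.
move=> am0 aMs ha hb.
have K0 : 0 <= `|a - b| * (((s - aM)^-1 + am^-1) * (1 + y `^ s)).
  rewrite mulr_ge0// mulr_ge0//; last by rewrite addr_ge0// powR_ge0.
  by rewrite addr_ge0// invr_ge0 ?subr_ge0 ltW.
(* For y <= 0 the two powers coincide: both are 1 by convention when y < 0, and both are 0 at y = 0
   because the exponents are positive. *)
have [y0|y0|y0] := ltgtP y 0.
- by apply: le_trans K0; rewrite !lt0_powR1// subrr normr0.
- by apply: powR_dist_le => //; exact: ln_powR_le.
- have nz c : am <= c <= aM -> c != 0.
    by case/andP => amc _; rewrite gt_eqF// (lt_le_trans am0 amc).
  by apply: le_trans K0; rewrite y0 !powR0 ?nz// subrr normr0.
Qed.

Lemma powR_ge1 (R : realType) (a p : R) : 1 <= a -> 0 <= p -> 1 <= a `^ p.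
Proof. by move=> a1 p0; rewrite -[leLHS](powRr0 a) ler_powR. Qed.

Lemma powR_le1D (R : realType) (y p q : R) : 0 < p <= q -> y `^ p <= 1 + y `^ q.
Proof.
move=> /andP[p0 pq]; have yq := powR_ge0 y q.
have [y1|y1] := leP 1 y.
  by have := ler_powR y1 pq; lra.
have [y0|y0|y0] := ltgtP y 0.
- by rewrite !lt0_powR1// lerDl.
- have y01 : 0 < y <= 1 by rewrite y0 ltW.
  have := ger_powR y01 (ltW p0).
  by rewrite powRr0; lra.
- by rewrite y0 powR0 ?gt_eqF// addr_ge0 ?powR_ge0.
Qed.

(* Unlike [ge0_le_integral], neither function has to be measurable: the supremum
   over the uncountable set of tail parameters is only compared to a bound. *)
Lemma ge0_le_integralT (d : measure_display) (T : measurableType d)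
    (R : realType) (mu : {measure set T -> \bar R}) (f g : T -> \bar R) :
  (forall x, 0 <= f x)%E -> (forall x, f x <= g x)%E ->
  (\int[mu]_x f x <= \int[mu]_x g x)%E.
Proof.
move=> f0 fg; have g0 x : (0 <= g x)%E by exact: le_trans (f0 x) (fg x).
rewrite !ge0_integralTE//; apply: le_ereal_sup => _ [h /= hf <-].
by exists h => //= x; exact: le_trans (hf x) (fg x).
Qed.

(** * Moments of 1/V - 1 of order below one *)

Lemma nneseries_geometric_le (R : realType) (a z : R) :
  0 <= a -> 0 <= z < 1 -> (\sum_(k <oo) (a * z ^+ k)%:E <= (a / (1 - z))%:E)%E.
Proof.
move=> a0 /andP[z0 z1].
have pos k : (0 <= (a * z ^+ k)%:E)%E by rewrite lee_fin mulr_ge0// exprn_ge0.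
apply: lime_le; first exact: is_cvg_nneseries.
apply: nearW => n; rewrite sumEFin lee_fin.
have := geometric_seriesE a (negbT (lt_eqF z1)).
move=> /(congr1 (fun f => f n)); rewrite /series /geometric /= => ->.
rewrite ler_pM2r ?invr_gt0 ?subr_gt0// ler_piMr// gerBl exprn_ge0//.
Qed.

Lemma measurable_funV (d : measure_display) (T : measurableType d)
    (R : realType) (f : T -> R) :
  measurable_fun [set: T] f -> measurable_fun [set: T] (fun x => (f x)^-1).
Proof.
move=> mf; rewrite (_ : (fun _ => _) = (fun x => f x * (f x ^+ 2) `^ (-1))).
  apply: measurable_funM => //.
  exact: (measurableT_comp (measurable_powR (-1)) (measurable_funX 2 mf)).
apply/funext => x; rewrite powR_inv1 ?sqr_ge0//.
have [->|fx0] := eqVneq (f x) 0; first by rewrite invr0 mul0r.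
by rewrite expr2 invfM mulrA divff// mul1r.
Qed.

(** The least n with 2^-n < v is positive since v <= 1; k is its predecessor. *)
Lemma dyadic_bracket (R : realType) (v : R) : 0 < v <= 1 ->
  exists k : nat, 2 ^- k.+1 < v <= 2 ^- k.
Proof.
move=> /andP[v0 v1].
have ex : exists n, (2 : R) ^- n < v.
  exists (Num.Def.archi_bound v^-1).
  rewrite -[ltRHS]invrK ltf_pV2 ?posrE ?invr_gt0 ?exprn_gt0//.
  exact: upper_nthrootP.
case: (ex_minnP ex) => -[|k] hk hmin; first by move: hk; rewrite expr0 invr1; lra.
exists k; rewrite hk/= leNgt; apply/negP => /hmin; by rewrite ltnn.
Qed.

Section odds_moment.
Context (d : measure_display) (T : measurableType d) (R : realType)
  (P : probability T R) (V : T -> R).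
Hypothesis mV : measurable_fun [set: T] V.
Hypothesis V_unif : forall t, 0 <= t <= 1 -> P [set w | V w <= t] = t%:E.

Let odds (w : T) := (V w)^-1 - 1.

(* [A 0] also covers the null event [V \notin ]0, 1]], where the base of the
   power is negative and [`^] takes the value 1. *)
Let A (k : nat) : set T := if k is 0 then setT else [set w | V w <= 2 ^- k].

Let mle t : measurable [set w | V w <= t].
Proof.
have := mV measurableT (measurable_itv `]-oo, t]); rewrite setTI.
by congr (measurable _); apply/seteqP; split => w /=; rewrite in_itv.
Qed.

Let mA k : measurable (A k).
Proof. by case: k => [|k]; [exact: measurableT|exact: mle]. Qed.

Let PA k : P (A k) = (2 ^- k)%:E.
Proof.
case: k => [|k]; first by rewrite probability_setT expr0 invr1.
by rewrite V_unif// invr_ge0 exprn_ge0//= invf_le1 ?exprn_gt0// exprn_ege1// ler1n.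
Qed.

(** Where V > 2^-(k+1) the odds are below 2^(k+1), hence the shifted power. The sets [A k] are
    nested rather than disjoint, which only enlarges the sum and gives them the exact probability
    2^-k. *)
Let term (q : R) (k : nat) (w : T) : \bar R :=
  ((2 `^ q) ^+ k.+1)%:E * (\1_(A k) w)%:E.

Let term_ge0 q k w : (0 <= term q k w)%E.
Proof. by rewrite mule_ge0// lee_fin// exprn_ge0// powR_ge0. Qed.

Let term_le_series q k w : w \in A k ->
  (((2 `^ q) ^+ k.+1)%:E <= \sum_(j <oo) term q j w)%E.
Proof.
(* The partial sum of length k + 1 is the first to contain the term of index k. *)
move=> wA; apply: le_trans (nneseries_lim_ge k.+1 _) => //.
rewrite big_nat_recr//= [X in (_ <= _ + X)%E]/term indicE wA mule1 leeDr//.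
by apply: sume_ge0 => j _; exact: term_ge0.
Qed.

Let odds_le_series q w : 0 < q ->
  ((odds w `^ q)%:E <= \sum_(j <oo) term q j w)%E.
Proof.
move=> q0; have [/dyadic_bracket[k /andP[kv vk]]|V01] := boolP (0 < V w <= 1).
  have V0 : 0 < V w by apply: lt_trans kv; rewrite invr_gt0 exprn_gt0.
  have wA : w \in A k by case: k kv vk => [|k] _ vk; apply/mem_set.
  apply: le_trans (term_le_series q wA); rewrite lee_fin.
  have ViB : (V w)^-1 <= 2 ^+ k.+1.
    by rewrite -[leRHS]invrK lef_pV2 ?posrE ?invr_gt0 ?exprn_gt0// ltW.
  rewrite -powR_mulrn ?powR_ge0// -powRrM mulrC powRrM powR_mulrn//.
  have [y_ge0|y_lt0] := leP 0 (odds w).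
    apply: (ge0_ler_powR (ltW q0)); rewrite ?nnegrE ?exprn_ge0//.
    by apply: le_trans ViB; rewrite gerBl.
  by rewrite lt0_powR1// powR_ge1 ?exprn_ege1 ?ler1n// ltW.
have odds_neg : odds w < 0.
  move: V01; rewrite negb_and -!ltNge -leNgt => /orP[V0|V1].
    by rewrite subr_lt0 (le_lt_trans _ ltr01)// invr_le0.
  by rewrite subr_lt0 invf_lt1// (lt_trans ltr01).
have wA : w \in A 0 by apply/mem_set.
apply: le_trans (term_le_series q wA); rewrite lee_fin lt0_powR1// expr1.
by rewrite powR_ge1 ?ler1n// ltW.
Qed.

(** Term k integrates to 2^(q(k+1)) 2^-k, a geometric sequence of ratio 2^q / 2, which is below 1
    because q < 1. *)
Lemma odds_moment_le (q : R) : 0 < q < 1 ->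
  (\int[P]_w ((odds w) `^ q)%:E <= (2 `^ q / (1 - 2 `^ q / 2))%:E)%E.
Proof.
move=> /andP[q0 q1].
apply: (@le_trans _ _ (\int[P]_w \sum_(j <oo) term q j w)%E).
  apply: ge0_le_integralT => w; first by rewrite lee_fin powR_ge0.
  exact: odds_le_series.
have mterm k : measurable_fun setT (term q k).
  apply: emeasurable_funM; first exact: measurable_cst.
  by apply/measurable_EFinP; exact: measurable_indic.
have int_term k : (\int[P]_w term q k w = (2 `^ q * (2 `^ q / 2) ^+ k)%:E)%E.
  rewrite ge0_integralZl_EFin//; last first.
    by apply/measurable_EFinP; exact: measurable_indic.
  rewrite integral_indic// setIT.
  have -> : ((2 `^ q * (2 `^ q / 2) ^+ k)%:E = ((2 `^ q) ^+ k.+1)%:E * (2 ^- k)%:E)%E.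
    by rewrite -EFinM exprS expr_div_n mulrA.
  by congr (_ * _)%E; exact: PA.
rewrite integral_nneseries// (eq_eseriesr (fun k _ => int_term k)).
apply: nneseries_geometric_le; first exact: powR_ge0.
rewrite divr_ge0 ?powR_ge0//= ltr_pdivrMr// mul1r.
have ln2 : 0 < ln 2 :> R by rewrite ln_gt0 ?ltr1n.
rewrite /powR gt_eqF//= -[ltRHS](lnK (_ : 2 \is Num.pos)) ?posrE//.
by rewrite ltr_expR gtr_pMl.
Qed.

End odds_moment.
(* Lies strictly between the largest exponent [(2 + lo)^-1] of the draws and
   [1 / 2]: the first gap absorbs the logarithm, the second one leaves a
   finite second moment. *)
Definition dominating_exponent (R : realType) (lo : R) : R := (2 + lo / 2)^-1.

(** Bounds the mean of 1 + odds^(2s), s being the dominating exponent: the geometric sum of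
    [odds_moment_le] at q = 2s. *)
Definition dominating_moment (R : realType) (lo : R) : R :=
  let q := 2 * dominating_exponent lo in 1 + 2 `^ q / (1 - 2 `^ q / 2).

(** The factor of [powR_exponent_lipschitz] for exponents between am = 1/(2+hi) and aM =
    1/(2+lo). *)
Definition lipschitz_constant (R : realType) (lo hi : R) : R :=
  (dominating_exponent lo - (2 + lo)^-1)^-1 + (2 + hi).

Lemma measurable_odds (d : measure_display) (T : measurableType d)
    (R : realType) (V : T -> R) :
  measurable_fun [set: T] V -> measurable_fun [set: T] (fun w => (V w)^-1 - 1).
Proof.
by move=> mV; apply: measurable_funB; [exact: measurable_funV|exact: measurable_cst].
Qed.

(** * Second moments and smoothness of the draws *)

Section draws.
Context (d : measure_display) (T : measurableType d) (R : realType)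
  (P : probability T R) (V : T -> R) (lo : R).
Hypothesis mV : measurable_fun [set: T] V.
Hypothesis V_unif : forall t, 0 <= t <= 1 -> P [set w | V w <= t] = t%:E.
Hypothesis lo_gt0 : 0 < lo.

Let odds (w : T) := (V w)^-1 - 1.
Let s := dominating_exponent lo.

Let s_gt0 : 0 < s.
Proof. by rewrite /s /dominating_exponent invr_gt0; have := lo_gt0; lra. Qed.

Let s_lt : 2 * s < 1.
Proof.
have lo0 := lo_gt0; have h : 0 < 2 + lo / 2 by lra.
by rewrite /s /dominating_exponent ltr_pdivrMr// mul1r; lra.
Qed.

Let lt_s : (2 + lo)^-1 < s.
Proof.
have lo0 := lo_gt0; have h : 0 < 2 + lo / 2 by lra.
by rewrite /s /dominating_exponent ltf_pV2 ?posrE; lra.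
Qed.

Let dominating w := 1 + odds w `^ (2 * s).

Let mdominating : measurable_fun [set: T] (EFin \o dominating).
Proof.
apply/measurable_EFinP; apply: measurable_funD; first exact: measurable_cst.
exact: (measurableT_comp (measurable_powR (2 * s)) (measurable_odds mV)).
Qed.

Let dominating_ge0 w : 0 <= dominating w.
Proof. by rewrite addr_ge0 ?powR_ge0. Qed.

Let dominating_le : (\int[P]_w (dominating w)%:E <= (dominating_moment lo)%:E)%E.
Proof.
under eq_integral do rewrite EFinD.
rewrite ge0_integralD//; last 2 first.
- by move=> w _; rewrite lee_fin powR_ge0.
- apply/measurable_EFinP.
  exact: (measurableT_comp (measurable_powR (2 * s)) (measurable_odds mV)).
rewrite integral_cst// mul1e [X in (X + _)%E]probability_setT EFinD leeD2l//.
by apply: odds_moment_le => //; rewrite s_lt mulr_gt0.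
Qed.

(** Squaring doubles the exponent, and 2/(2+xi) <= 2s, so the square is at most 1 + odds^(2s). *)
Lemma draw_second_moment_le (xi : R) : lo <= xi ->
  (\int[P]_w ((odds w `^ (2 + xi)^-1) ^+ 2)%:E <= (dominating_moment lo)%:E)%E.
Proof.
have lo0 := lo_gt0; move=> xi_ge; apply: le_trans dominating_le.
apply: ge0_le_integralT => w; rewrite lee_fin ?sqr_ge0//.
rewrite -powR_mulrn ?powR_ge0// -powRrM; apply: powR_le1D.
have xi0 : 0 < 2 + xi by lra.
rewrite mulr_gt0 ?invr_gt0//= mulrC ler_pM2l//.
by apply: le_trans (ltW lt_s); rewrite lef_pV2 ?posrE; lra.
Qed.

(** The pointwise bound depends on the parameters only through delta, so it passes to the supremum
    before integration. *)
Lemma draw_L2_smooth (hi C : R) : lo <= hi ->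
  lipschitz_constant lo hi * Num.sqrt (2 * dominating_moment lo) <= C ->
  L2_smooth P lo hi C (fun xi w => odds w `^ (2 + xi)^-1).
Proof.
have lo0 := lo_gt0; move=> lohi CB delta delta0.
set K := lipschitz_constant lo hi in CB *.
set M := dominating_moment lo in CB *.
have hi0 : 0 < 2 + hi by lra.
have K0 : 0 <= K by rewrite addr_ge0 ?ltW// invr_gt0 subr_gt0.
have M0 : 0 <= M.
  rewrite -lee_fin; apply: le_trans dominating_le; apply: integral_ge0 => w _.
  by rewrite lee_fin.
have exp_itv x : lo <= x <= hi -> (2 + hi)^-1 <= (2 + x)^-1 <= (2 + lo)^-1.
  by move=> /andP[? ?]; rewrite !lef_pV2 ?posrE; lra.
(* The map xi -> 1/(2+xi) is 1-Lipschitz, as both denominators exceed 1. *)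
have exp_dist x y : lo <= x <= hi -> lo <= y <= hi ->
    `|(2 + x)^-1 - (2 + y)^-1| <= `|x - y|.
  move=> /andP[lx _] /andP[ly _].
  have x1 : 1 < 2 + x by lra.
  have y1 : 1 < 2 + y by lra.
  have -> : (2 + x)^-1 - (2 + y)^-1 = (y - x) / ((2 + x) * (2 + y)).
    by field; lra.
  rewrite normrM distrC ler_piMr// ger0_norm ?invr_ge0 ?mulr_ge0 ?invf_le1; nra.
have bound w x y : lo <= x <= hi -> lo <= y <= hi -> `|x - y| <= delta ->
    `|odds w `^ (2 + x)^-1 - odds w `^ (2 + y)^-1| ^+ 2 <=
    2 * (K * delta) ^+ 2 * dominating w.
  move=> hx hy hxy; have am0 : 0 < (2 + hi)^-1 by rewrite invr_gt0.
  have := powR_exponent_lipschitz (odds w) am0 lt_s (exp_itv _ hx) (exp_itv _ hy).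
  rewrite invrK -/K => le1.
  have o0 := powR_ge0 (odds w) s.
  have le2 : `|odds w `^ (2 + x)^-1 - odds w `^ (2 + y)^-1| <=
      (K * delta) * (1 + odds w `^ s).
    apply: (le_trans le1); rewrite mulrA (mulrC K).
    rewrite ler_wpM2r ?addr_ge0// ler_wpM2r//.
    exact: le_trans (exp_dist _ _ hx hy) hxy.
  have -> : dominating w = 1 + (odds w `^ s) ^+ 2.
    by rewrite /dominating mulrC powRrM powR_mulrn ?powR_ge0.
  have Kd0 : 0 <= K * delta by rewrite mulr_ge0.
  apply: (le_trans (lerXn2r 2 _ _ le2)); rewrite ?nnegrE//.
    by rewrite mulr_ge0// addr_ge0.
  (* What remains is (1 + o)^2 <= 2 (1 + o^2), that is, (1 - o)^2 >= 0. *)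
  rewrite exprMn (mulrC 2) -[leRHS]mulrA.
  by rewrite ler_wpM2l ?sqr_ge0//; have := sqr_ge0 (1 - odds w `^ s); nra.
have C0 : 0 <= C by apply: le_trans CB; rewrite mulr_ge0 ?sqrtr_ge0.
rewrite (_ : (C * delta)%:E = sqrte ((C * delta) ^+ 2)%:E); last first.
  by rewrite /= sqrtr_sqr ger0_norm ?mulr_ge0.
rewrite lee_sqrt ?lee_fin ?sqr_ge0//.
apply: (@le_trans _ _ (\int[P]_w ((2 * (K * delta) ^+ 2)%:E * (dominating w)%:E))%E).
  apply: ge0_le_integralT => w.
    (* The supremum is nonnegative because the pair (lo, lo) contributes 0; this uses lo <= hi. *)
    apply: ereal_sup_ubound => /=; exists lo, lo.
    by rewrite lexx lohi !subrr normr0 expr0n; split.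
  by apply: ge_ereal_sup => _ [x [y [hx hy hxy ->]]]; rewrite -EFinM lee_fin bound.
have dominatingE w : setT w -> (0 <= (dominating w)%:E)%E by rewrite lee_fin.
rewrite ge0_integralZl_EFin//; last by rewrite mulr_ge0 ?sqr_ge0.
apply: (@le_trans _ _ ((2 * (K * delta) ^+ 2)%:E * M%:E)%E).
  by rewrite lee_wpmul2l ?lee_fin ?mulr_ge0 ?sqr_ge0.
rewrite -EFinM lee_fin.
have -> : 2 * (K * delta) ^+ 2 * M = (K * Num.sqrt (2 * M) * delta) ^+ 2.
  by rewrite !exprMn sqr_sqrtr ?mulr_ge0//; ring.
rewrite ler_pXn2r ?nnegrE ?mulr_ge0 ?sqrtr_ge0//.
by rewrite ler_wpM2r.
Qed.

End draws.

(** * Recognizing a density *)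

Section density.
Context (R : realType) (f : R -> R).
Hypothesis mf : measurable_fun [set: R] f.
Hypothesis f_ge0 : forall x, 0 <= f x.

Let nu (A : set R) : \bar R :=
  (\int[lebesgue_measure]_(x in A) (f x)%:E)%E.

Let nu0 : nu set0 = 0%E.
Proof. by rewrite /nu integral_set0. Qed.

Let nu_ge0 A : (0 <= nu A)%E.
Proof. by apply: integral_ge0 => x _; rewrite lee_fin. Qed.

Let nu_sigma_additive : semi_sigma_additive nu.
Proof.
move=> /= F mF tF mUF; rewrite /nu; apply: cvg_toP.
  apply: ereal_nondecreasing_is_cvgn => m n mn.
  by apply: lee_sum_nneg_natr => // k _ _; exact: nu_ge0.
rewrite ge0_integral_bigcup//=.
- by apply/measurable_funTS/measurableT_comp.
- by move=> x _; rewrite lee_fin.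
Qed.

HB.instance Definition _ := isMeasure.Build _ _ _
  nu nu0 nu_ge0 nu_sigma_additive.

Context (d : measure_display) (T : measurableType d) (P : probability T R)
  (X : T -> R).
Hypothesis mX : measurable_fun [set: T] X.

Let mX_mixin := isMeasurableFun.Build _ _ _ _ _ mX.
Let X_rv : {mfun T >-> R} := HB.pack X mX_mixin.

(** Closed right rays are stable under intersection and generate the Borel sets, and the rays [g n]
    cover the line with finite mass, so two measures that agree on rays are equal. *)
Lemma has_density_rays :
  (forall a, P (X @^-1` `[a, +oo[) =
     \int[lebesgue_measure]_(x in `[a, +oo[) (f x)%:E)%E ->
  has_density P X f.
Proof.
move=> rays; split => // A mA.
pose G := @RGenCInfty.G R.
have GE : @measurable _ R = <<s G >> := RGenCInfty.measurableE R.
pose g (n : nat) : set R := `[- n%:R, +oo[%classic.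
pose m1 : {measure set R -> \bar R} := distribution P X_rv.
pose m2 : {measure set R -> \bar R} := nu.
change (m1 A = m2 A).
apply: (@g_sigma_algebra_measure_unique _ R R G _ g _ _ m1 m2) => //.
- by rewrite GE; exact: sub_sigma_algebra.
- by move=> n; exists (- n%:R).
- apply/seteqP; split => // x _; exists (Num.Def.archi_bound `|x|) => //.
  rewrite /g/= in_itv/= andbT lerNl (le_trans (ler_norm _))// normrN ltW//.
  exact: archi_boundP.
- move=> _ _ [a ->] [b ->]; exists (Order.max a b).
  by apply/seteqP; split => x /=; rewrite !in_itv/= !andbT ge_max => /andP.
- by move=> _ [a ->]; exact: rays.
- move=> n; apply: le_lt_trans (ltry 1).
  by apply: (@probability_le1 _ _ _ (distribution P X_rv)); exact: measurable_itv.
- by rewrite -GE.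
Qed.

End density.

(** Change of variables x -> -x, under which Lebesgue measure is invariant. *)
Lemma has_density_opp (d : measure_display) (T : measurableType d)
    (R : realType) (P : probability T R) (X : T -> R) (f : R -> R) :
  has_density P X f -> has_density P (fun w => - X w) (fun x => f (- x)).
Proof.
move=> [mX mf f0 PX]; split => //.
- exact: measurable_funN.
- by apply: (measurableT_comp mf); exact: oppr_measurable.
move=> A mA.
have mN : measurable ((-%R : R -> R) @^-1` A).
  by rewrite -[X in measurable X]setTI; exact: oppr_measurable.
rewrite [LHS](PX _ mN).
transitivity (\int[pushforward lebesgue_measure (-%R : _ -> measurableTypeR R)]_
    (x in (-%R : R -> R) @^-1` A) (f x)%:E)%E.
  by apply: eq_measure_integral => B mB _; exact/esym/lebesgue_measureN.
rewrite ge0_integral_pushforward//; last by move=> x _; rewrite lee_fin.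
  rewrite (_ : _ @^-1` (_ @^-1` A) = A)//.
  by apply/seteqP; split => x /=; rewrite opprK.
apply/measurable_EFinP; exact: measurable_funTS.
Qed.

(** * The density of the draws and its tail *)

Lemma powR_continuous (R : realType) (a p : R) :
  0 < a -> {for a, continuous (fun x : R => x `^ p)}.
Proof.
move=> a0; apply/differentiable_continuous/derivable1_diffP.
by apply: derivable_powR; rewrite in_itv/= a0.
Qed.

(** Only the right limit is available at a = 0: negative bases have power 1, so the function jumps
    there. *)
Lemma powR_at_right (R : realType) (a p : R) : 0 <= a -> 0 < p ->
  x `^ p @[x --> a^'+] --> a `^ p.
Proof.
rewrite le_eqVlt => /predU1P[<-|a0] p0.
  by rewrite powR0 ?gt_eqF//; exact: powR_cvg0.
by apply: cvg_at_right_filter; exact: powR_continuous.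
Qed.

Lemma powR_cvgy (R : realType) (p : R) : 0 < p -> x `^ p @[x --> +oo] --> +oo.
Proof.
move=> p0; apply/cvgryPge => A; near=> x.
have x0 : 0 <= x by near: x; exact: nbhs_pinfty_ge.
have AB : `|A| `^ p^-1 <= x by near: x; exact: nbhs_pinfty_ge.
apply: (le_trans (ler_norm A)).
have -> : `|A| = (`|A| `^ p^-1) `^ p.
  by rewrite -powRrM mulVf ?gt_eqF// powRr1.
by apply: (ge0_ler_powR (ltW p0)); rewrite ?nnegrE ?powR_ge0.
Unshelve. all: by end_near. Qed.

Section tail.
Context (R : realType) (b : R).
Hypothesis b_gt1 : 1 < b.

(** The log-logistic density of shape b, minus the derivative of 1/(1 + x^b). For x < 0 the formula
    would give b/4, hence the restriction in [tail_density]. *)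
Definition tail_density_pos (x : R) : R :=
  b * x `^ (b - 1) / (1 + x `^ b) ^+ 2.

Definition tail_density : R -> R := tail_density_pos \_ `[0, +oo[.

Let D_gt0 (x : R) : 0 < 1 + x `^ b.
Proof. by rewrite ltr_pwDl// powR_ge0. Qed.

Let b_gt0 : 0 < b.
Proof. exact: lt_trans b_gt1. Qed.

Lemma tail_density_pos_ge0 x : 0 <= tail_density_pos x.
Proof.
by rewrite /tail_density_pos divr_ge0 ?sqr_ge0// mulr_ge0 ?powR_ge0// ltW.
Qed.

Lemma tail_density_ge0 x : 0 <= tail_density x.
Proof. by apply: restrict_ge0 => y _; exact: tail_density_pos_ge0. Qed.

Lemma measurable_tail_density : measurable_fun [set: R] tail_density.
Proof.
apply/measurable_restrict => //; apply: measurable_funTS.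
apply: measurable_funM.
  by apply: measurable_funM => //; exact: measurable_powR.
by apply: measurable_funV; apply: measurable_funX; apply: measurable_funD.
Qed.

Let survival (x : R) := (1 + x `^ b)^-1.

Lemma survival_cvgy : survival x @[x --> +oo] --> 0.
Proof.
apply/gtr0_cvgV0; first by apply: nearW => x; exact: D_gt0.
apply/cvgryPge => A; near=> x.
have : A <= x `^ b by near: x; move/cvgryPge: (powR_cvgy b_gt0); exact.
by have : 0 < (1 : R) by []; lra.
Unshelve. all: by end_near. Qed.

Let survival_at_right (a : R) : 0 <= a -> survival x @[x --> a^'+] --> survival a.
Proof.
move=> a0; apply: cvgV; first exact: lt0r_neq0.
by apply: cvgD; [exact: cvg_cst|exact: powR_at_right].
Qed.

Let density_at_right (a : R) : 0 <= a ->
  tail_density_pos x @[x --> a^'+] --> tail_density_pos a.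
Proof.
move=> a0; apply: cvgM.
  apply: cvgM; first exact: cvg_cst.
  by apply: powR_at_right => //; rewrite subr_gt0.
apply: cvgV; first by rewrite expf_neq0 ?lt0r_neq0.
rewrite expr2; apply: cvgM;
  by apply: cvgD; [exact: cvg_cst|exact: powR_at_right].
Qed.

Let density_continuous (a : R) : 0 < a -> {for a, continuous tail_density_pos}.
Proof.
move=> a0; apply: cvgM.
  by apply: cvgM; [exact: cvg_cst|exact: powR_continuous].
apply: cvgV; first by rewrite expf_neq0 ?lt0r_neq0.
rewrite expr2; apply: cvgM;
  by apply: cvgD; [exact: cvg_cst|exact: powR_continuous].
Qed.

Let is_derive_survival (a : R) : 0 < a ->
  is_derive a 1 (fun x => - survival x) (tail_density_pos a).
Proof.
move=> a0.
have dp : is_derive a 1 (fun x : R => 1 + x `^ b) (b * a `^ (b - 1)).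
  rewrite -[X in is_derive _ _ _ X]add0r.
  by apply: is_deriveD; exact: is_derive1_powR.
have dV := @is_deriveV R (fun x => 1 + x `^ b) a _ 1 (lt0r_neq0 (D_gt0 a)) dp.
have := is_deriveN dV; rewrite /survival => h.
apply: (is_derive_eq h).
by rewrite scaleNr opprK /GRing.scale/= mulrC.
Qed.

Lemma integral_tail_density (a : R) :
  (\int[lebesgue_measure]_(x in `[a, +oo[) (tail_density x)%:E =
   (1 + (Num.max a 0) `^ b)^-1%:E)%E.
Proof.
set a' := Num.max a 0.
have a'0 : 0 <= a' by rewrite le_max lexx orbT.
transitivity (\int[lebesgue_measure]_(x in `[a', +oo[) (tail_density_pos x)%:E)%E.
  have -> : `[a', +oo[%classic = `[a, +oo[ `&` `[0, +oo[ :> set R.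
    by apply/seteqP; split => x /=; rewrite !in_itv/= !andbT ge_max => /andP.
  by rewrite [RHS]integral_mkcondr; apply: eq_integral => x _; rewrite restrict_EFin.
(* The antiderivative [- survival] tends to 0 at infinity, so only its value at the left end [a']
   remains. *)
rewrite (@ge0_continuous_FTC2y _ _ (fun x => - survival x) _ 0)//.
- by rewrite sub0e EFinN oppeK.
- by move=> x _; exact: tail_density_pos_ge0.
- apply/continuous_within_itvcyP; split; last exact: density_at_right.
  move=> x; rewrite in_itv/= andbT => a'x; apply: density_continuous.
  exact: le_lt_trans a'x.
- by rewrite -oppr0; apply: cvgN; exact: survival_cvgy.
- move=> x a'x.
  by have [] := is_derive_survival (le_lt_trans a'0 a'x).
- by apply: cvgN; exact: survival_at_right.
- move=> x; rewrite in_itv/= andbT => a'x; rewrite derive1E.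
  by have [] := is_derive_survival (le_lt_trans a'0 a'x).
Qed.

Lemma tail_density_same_tail :
  same_tail +oo tail_density (fun e => e `^ (- b - 1)).
Proof.
exists b => //.
(* For x > 0 the ratio is b (x^b / (1 + x^b))^2, which is this expression. *)
have : b * (1 - survival x) ^+ 2 @[x --> +oo] --> b * (1 - 0) ^+ 2.
  apply: cvgM; first exact: cvg_cst.
  rewrite expr2; apply: cvgM; apply: cvgB; (try exact: cvg_cst);
  exact: survival_cvgy.
rewrite subr0 expr1n mulr1; apply: cvg_trans; apply: near_eq_cvg; near=> x.
have x0 : 0 < x by near: x; exact: nbhs_pinfty_gt.
rewrite /tail_density patchE mem_set/=; last by rewrite in_itv/= ltW.
rewrite /tail_density_pos /survival.
have xb0 : 0 < x `^ b by exact: powR_gt0.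
have pB c : x `^ (c - 1) = x `^ c / x.
  by rewrite powRB ?powRr1 ?ltW// (gt_eqF x0) implybT.
rewrite !pB powRN.
by field; rewrite !gt_eqF// ltr_pwDl// ltW.
Unshelve. all: by end_near. Qed.

End tail.

(** By [has_density_rays] it suffices to compare survival functions: for a > 0, almost surely Y >= a
    exactly when V <= 1/(1 + a^b). *)
Lemma draw_has_density (d : measure_display) (T : measurableType d)
    (R : realType) (P : probability T R) (V : T -> R) (b : R) :
  measurable_fun [set: T] V ->
  (forall t, 0 <= t <= 1 -> P [set w | V w <= t] = t%:E) -> 1 < b ->
  has_density P (fun w => ((V w)^-1 - 1) `^ b^-1) (tail_density b).
Proof.
move=> mV V_unif b1; have b0 : 0 < b by exact: lt_trans b1.
pose Y w := ((V w)^-1 - 1) `^ b^-1.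
have mY : measurable_fun [set: T] Y.
  exact: (measurableT_comp (measurable_powR b^-1) (measurable_odds mV)).
apply: has_density_rays => //.
- exact: measurable_tail_density.
- by move=> x; apply: tail_density_ge0.
move=> a; rewrite integral_tail_density//.
have mYa : measurable (Y @^-1` `[a, +oo[).
  by rewrite -[X in measurable X]setTI; apply: mY => //; exact: measurable_itv.
have [a0|a0] := leP a 0.
  rewrite powR0 ?gt_eqF// addr0 invr1 (_ : _ @^-1` _ = setT) ?probability_setT//.
  by apply/seteqP; split => // w _ /=; rewrite in_itv/= andbT (le_trans a0)// powR_ge0.
have mle t : measurable [set w | V w <= t].
  rewrite (_ : [set w | _] = V @^-1` `]-oo, t]); last first.
    by apply/seteqP; split => w /=; rewrite in_itv.
  by rewrite -[X in measurable X]setTI; apply: mV => //; exact: measurable_itv.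
have a_ge0 := ltW a0; set t := (1 + a `^ b)^-1.
have D1 : 1 <= 1 + a `^ b by rewrite lerDl powR_ge0.
have t01 : 0 <= t <= 1.
  by rewrite invr_ge0 invf_le1 ?D1 ?(le_trans _ D1)// (lt_le_trans _ D1).
(* Off this null set 0 < V <= 1, so the odds are nonnegative and raising to the power b undoes the
   power 1/b. *)
pose N := [set w | V w <= 0] `|` ~` [set w | V w <= 1].
have mN : measurable N by apply: measurableU => //; exact: measurableC.
have PN : P N = 0%E.
  have P0 : P [set w | V w <= 0] = 0%E by rewrite V_unif// lexx ler01.
  have P1 : P (~` [set w | V w <= 1]) = 0%E.
    by rewrite probability_setC// V_unif ?ler01 ?lexx// subee.
  by rewrite /N measureU0//; exact: measurableC.
have Y_le w : ~ N w -> (a <= Y w) = (V w <= t).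
  move=> /not_orP[/negP]; rewrite -ltNge => V0 /contrapT /= V1.
  have odds0 : 0 <= (V w)^-1 - 1 by rewrite subr_ge0 invf_ge1.
  have -> : (a <= Y w) = (a `^ b <= (V w)^-1 - 1).
    have YE : (V w)^-1 - 1 = Y w `^ b by rewrite /Y -powRrM mulVf ?gt_eqF// powRr1.
    apply/idP/idP => [aY|].
      by rewrite YE; apply: (ge0_ler_powR (ltW b0)); rewrite ?nnegrE ?powR_ge0 ?a_ge0.
    rewrite YE; apply: contraTT; rewrite -!ltNge => Ya.
    by apply: (gt0_ltr_powR b0); rewrite ?nnegrE ?powR_ge0 ?a_ge0.
  rewrite lerBrDl /t -[in RHS](invrK (V w)).
  by rewrite lef_pV2 ?posrE ?invr_gt0// (lt_le_trans _ D1).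
(* The two events need agree only off [N]; adjoining [N] to both makes them equal without changing
   their probabilities. *)
transitivity (P (Y @^-1` `[a, +oo[ `|` N)); first by rewrite measureU0.
transitivity (P ([set w | V w <= t] `|` N)); last first.
  by rewrite measureU0//; exact: V_unif.
congr (P _); apply/seteqP; split => w /=; rewrite in_itv/= andbT.
  by move=> [aY|]; [have [|nN] := pselect (N w); [right|left; rewrite -Y_le]|right].
by move=> [Vt|]; [have [|nN] := pselect (N w); [right|left; rewrite Y_le]|right].
Qed.

(** * Distribution functions of the uniform draws, and conclusion *)

Lemma uniform_prob_sub_itv (R : realType) (A : set R) (a b : R) :
  0 <= a -> a <= b -> b <= 1 -> A `&` `[0, 1]%classic = `[a, b]%classic ->
  uniform_prob (@ltr01 R) A = (b - a)%:E.
Proof.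
move=> a0 ab b1 AE; rewrite /uniform_prob integral_uniform_pdf AE.
rewrite (eq_integral (cst 1%E)) => [|x]; last first.
  rewrite inE/= in_itv/= => /andP[ax xb].
  by rewrite /uniform_pdf (le_trans a0 ax) (le_trans xb b1) subr0 invr1.
rewrite integral_cst//= mul1e lebesgue_measure_itv/= lte_fin.
by case: ltgtP ab => // -> _; rewrite subrr.
Qed.

Section uniform01_cdf.
Context (d : measure_display) (T : measurableType d) (R : realType)
  (P : probability T R) (nu : {RV P >-> R}).
Hypothesis nu_unif : uniform01 nu.

Lemma uniform01_le (t : R) : 0 <= t <= 1 -> P [set w | nu w <= t] = t%:E.
Proof.
move=> /andP[t0 t1].
have := nu_unif (measurable_itv `]-oo, t]).
rewrite (@uniform_prob_sub_itv _ _ 0 t)// ?subr0 => [<-|].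
  by congr (P _); apply/seteqP; split => w /=; rewrite in_itv.
apply/seteqP; split => x /=; rewrite !in_itv/=.
  by move=> [xt /andP[-> _]].
by move=> /andP[-> xt]; rewrite xt (le_trans xt t1).
Qed.

Lemma uniform01_onem_le (t : R) : 0 <= t <= 1 -> P [set w | 1 - nu w <= t] = t%:E.
Proof.
move=> /andP[t0 t1].
have := nu_unif (measurable_itv `[1 - t, +oo[).
rewrite (@uniform_prob_sub_itv _ _ (1 - t) 1)// ?subr_ge0 ?gerBl// ?subKr => [<-|].
  by congr (P _); apply/seteqP; split => w /=; rewrite in_itv/= andbT lerBlDl -lerBlDr.
apply/seteqP; split => x /=; rewrite !in_itv/= andbT.
  by move=> [-> /andP[_ ->]].
by move=> /andP[xt ->]; rewrite xt (le_trans _ xt)// subr_ge0.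
Qed.

End uniform01_cdf.

Lemma L2_smooth_opp (d : measure_display) (T : measurableType d) (R : realType)
    (P : probability T R) (lo hi C : R) (e : R -> T -> R) :
  L2_smooth P lo hi C e -> L2_smooth P lo hi C (fun xi w => - e xi w).
Proof.
move=> sm delta delta0; have := sm delta delta0.
congr (sqrte _ <= _)%E; apply: eq_integral => w _; congr ereal_sup.
by apply/seteqP; split => z [x [y [hx hy hxy ->]]]; exists x, y; split => //;
  rewrite -opprD normrN.
Qed.

Theorem lemmaA2 (R : realType) (xi_lo xi_hi : R) (xi_lo_gt0 : 0 < xi_lo) :
  exists C : R,
    forall (d : measure_display) (T : measurableType d) (P : probability T R)
           (nu1 nu2 : {RV P >-> R}) (xi1 xi2 : R),
      uniform01 nu1 -> uniform01 nu2 ->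
      xi_lo <= xi1 <= xi_hi -> xi_lo <= xi2 <= xi_hi ->
      let e1 := fun (xi : R) (w : T) => left_draw xi (nu1 w) in
      let e2 := fun (xi : R) (w : T) => right_draw xi (nu2 w) in
      [/\ (exists2 f1 : R -> R, has_density P (e1 xi1) f1 &
             same_tail -oo f1 (fun e => `|e| `^ (- 3 - xi1))) /\
          (exists2 f2 : R -> R, has_density P (e2 xi2) f2 &
             same_tail +oo f2 (fun e => e `^ (- 3 - xi2))),
          ('E_P[(fun w => `|e1 xi1 w| ^+ 2)%R] <= C%:E)%E /\
          ('E_P[(fun w => `|e2 xi2 w| ^+ 2)%R] <= C%:E)%E,
          L2_smooth P xi_lo xi_hi C e1 &
          L2_smooth P xi_lo xi_hi C e2].
Proof.
pose M := dominating_moment xi_lo.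
pose L := lipschitz_constant xi_lo xi_hi * Num.sqrt (2 * M).
(* [M] serves the second moments and [L] the smoothness. Both are fixed before the sample space and
   the parameters, so they depend on the bounds alone. *)
exists (Num.max M L) => d T P nu1 nu2 xi1 xi2 unif1 unif2.
move=> /andP[lo1 hi1] /andP[lo2 hi2] e1 e2.
have lohi := le_trans lo1 hi1.
have mV1 : measurable_fun [set: T] nu1 by [].
have mV2 : measurable_fun [set: T] (fun w => 1 - nu2 w).
  by apply: measurable_funB.
have V1 := uniform01_le unif1.
have V2 := uniform01_onem_le unif2.
have leM : (M%:E <= (Num.max M L)%:E)%E by rewrite lee_fin le_max lexx.
have leL : L <= Num.max M L by rewrite le_max lexx orbT.
(* Matches the stated tail exponent with -b - 1 for b = 2 + xi. *)
have exponentE (xi : R) : - 3 - xi = - (2 + xi) - 1 by ring.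
split.
- split.
  + have b1 : 1 < 2 + xi1 by lra.
    exists (fun x => tail_density (2 + xi1) (- x)).
      exact/has_density_opp/draw_has_density.
    have [c c0 hc] := tail_density_same_tail b1; exists c => //.
    (* Reflection turns the limit at -oo into the limit at +oo already known for the unreflected
       density. *)
    apply/cvgNy_compNP; move: hc; apply: cvg_trans; apply: near_eq_cvg.
    near=> x; have x0 : 0 < x by near: x; exact: nbhs_pinfty_gt.
    by rewrite /= normrN opprK (gtr0_norm x0) exponentE.
  + have b1 : 1 < 2 + xi2 by lra.
    exists (tail_density (2 + xi2)); first exact: draw_has_density.
    by rewrite exponentE; exact: tail_density_same_tail.
- rewrite unlock; split; apply: le_trans leM.
  + under eq_integral do rewrite /e1 /left_draw normrN ger0_norm ?powR_ge0//.
    exact: draw_second_moment_le.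
  + under eq_integral do rewrite /e2 /right_draw ger0_norm ?powR_ge0//.
    exact: (draw_second_moment_le mV2).
- exact/L2_smooth_opp/draw_L2_smooth.
- exact: (draw_L2_smooth mV2).
Unshelve. all: by end_near. Qed.
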